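(* Every non-empty open subset (with the subspace topology) of an $\mathrm{I}$-favorable space is $\mathrm{I}$-favorable.
   Context: All topological spaces are Tychonoff and non-empty. $\mathrm{I}$-favorable: $X$ is $\mathrm{I}$-favorable if player I has a winning strategy in the open-open game, i.e. there is a function $\sigma$ assigning to every finite (possibly empty) sequence of non-empty open subsets of $X$ a non-empty open subset of $X$, such that for every sequence $(U_k)_{k\ge 0}$ of non-empty open subsets of $X$ with $U_0\subset\sigma(\varnothing)$ and $U_{k+1}\subset\sigma(U_0,\dots,U_k)$ for all $k\ge 0$, the union $\bigcup_{k\ge 0}U_k$ is dense in $X$. *)

(* Defs.v *)
From HB Require Import structures.
From mathcomp Require Import all_boot all_classical topology urysohn.

Set Implicit Arguments.
Unset Strict Implicit.
Unset Printing Implicit Defensive.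

Local Open Scope classical_set_scope.

(* [completely_regular_space] separates points from closed sets by a uniformity
   coarser than the topology; [uniform_separatorP] turns this into separation
   by a continuous function with values in [0, 1]. *)
Definition tychonoff_space (X : topologicalType) : Prop :=
  accessible_space X /\ completely_regular_space X.

Definition nonempty_open (X : topologicalType) : set (set X) :=
  [set U | open U /\ U !=set0].
Arguments nonempty_open : clear implicits.

(* Moves are elements of the type [nonempty_open X]; [mkseq U k.+1] is the
   sequence U_0, ..., U_k. *)
Definition winning_strategy (X : topologicalType)
    (sigma : seq (nonempty_open X) -> nonempty_open X) : Prop :=
  forall U : nat -> nonempty_open X,
    set_val (U 0) `<=` set_val (sigma [::]) ->
    (forall k, set_val (U k.+1) `<=` set_val (sigma (mkseq U k.+1))) ->
    dense (\bigcup_k set_val (U k)).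

Definition I_favorable (X : topologicalType) : Prop :=
  exists sigma : seq (nonempty_open X) -> nonempty_open X,
    winning_strategy sigma.

(* Main.v *)
Require Import Defs.
From mathcomp Require Import all_boot all_classical topology.

Set Implicit Arguments.
Unset Strict Implicit.
Unset Printing Implicit Defensive.

Local Open Scope classical_set_scope.

(** Let [sigma] win the open-open game on [X], and let [U] be open in [X].  On
    [U], player I runs an auxiliary game on [X] governed by [sigma].  A move of
    [sigma] that meets [U] is intersected with [U] and proposed in the real
    game; the answer of player II, which is open in [X] because [U] is, is also
    player II's answer in the auxiliary game.  A move of [sigma] disjoint from
    [U] cannot be proposed in the real game, so player II is made to accept it
    unchanged in the auxiliary game, and [sigma] is asked again.

    The auxiliary game is an infinite play following [sigma], so the union of
    its moves is dense in [X].  A move that meets [U] is an answer of player II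
    in the real game, so the union of these answers is dense in [U].

    It may happen that [sigma] stops meeting [U] after finitely many real
    answers.  The same argument then shows that those answers already have a
    union dense in [U], so that what player I proposes afterwards is irrelevant
    and may be anything. *)

Definition meets (X : topologicalType) (U : set X) (A : nonempty_open X) : bool :=
  `[< set_val A `&` U !=set0 >].

Lemma nonempty_open_setT (X : topologicalType) (U : set X) (hU0 : U !=set0) :
  nonempty_open (set_type U) [set: set_type U].
Proof.
split; first exact: openT.
by have [x Ux] := hU0; exists (SigSub (mem_set Ux)).
Qed.

(** The default value is what player I proposes once [sigma] has stopped
    meeting [U]; any move would do. *)
Definition restrict_move (X : topologicalType) (U : set X) (hU0 : U !=set0)
    (A : nonempty_open X) : nonempty_open (set_type U) :=
  insubd (SigSub (mem_set (nonempty_open_setT hU0)) : nonempty_open (set_type U))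
    (set_val @^-1` set_val A).

Lemma restrict_moveE (X : topologicalType) (U : set X) (hU0 : U !=set0)
    (A : nonempty_open X) : meets U A ->
  set_val (restrict_move hU0 A) = set_val @^-1` set_val A.
Proof.
move=> /asboolP[x [Ax Ux]]; rewrite set_valE /restrict_move insubdK//.
have [oA _] := set_valP A; apply: mem_set; split.
  by apply: open_comp oA => y _; exact: initial_continuous.
by exists (SigSub (mem_set Ux)).
Qed.

Lemma nonempty_open_image (X : topologicalType) (U : set X) (hU : open U)
    (V : set (set_type U)) : nonempty_open (set_type U) V ->
  nonempty_open X (set_val @` V).
Proof.
move=> [[B oB BV] [v Vv]]; split; last by exists (set_val v), v.
suff -> : set_val @` V = B `&` U by exact: openI.
rewrite -BV; apply/seteqP; split=> [_ [y By <-]|x [Bx Ux]].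
  by split=> //; exact: set_valP.
by exists (SigSub (mem_set Ux)).
Qed.

Definition extend_move (X : topologicalType) (U : set X) (hU : open U)
    (V : nonempty_open (set_type U)) : nonempty_open X :=
  SigSub (mem_set (nonempty_open_image hU (set_valP V))).

Lemma extend_moveE (X : topologicalType) (U : set X) (hU : open U)
    (V : nonempty_open (set_type U)) :
  set_val (extend_move hU V) = set_val @` set_val V.
Proof. exact: (congr1 (@^~ (extend_move hU V)) set_valE). Qed.

Definition accept (X : topologicalType)
    (sigma : seq (nonempty_open X) -> nonempty_open X)
    (s : seq (nonempty_open X)) : seq (nonempty_open X) :=
  rcons s (sigma s).

Definition first_meeting (X : topologicalType) (U : set X)
    (sigma : seq (nonempty_open X) -> nonempty_open X)
    (s : seq (nonempty_open X)) (i : nat) : Prop :=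
  meets U (sigma (iter i (accept sigma) s)) /\
  forall k, (k < i)%N -> ~~ meets U (sigma (iter k (accept sigma) s)).

(** Player II accepts the moves of [sigma] until one of them can be proposed in
    the real game.  If [sigma] never meets [U] again, the default [0] leaves [s]
    unchanged: the real game is then already won, so the value is immaterial. *)
Definition advance (X : topologicalType) (U : set X)
    (sigma : seq (nonempty_open X) -> nonempty_open X)
    (s : seq (nonempty_open X)) : seq (nonempty_open X) :=
  iter (xget 0 (first_meeting U sigma s)) (accept sigma) s.

Lemma advanceE (X : topologicalType) (U : set X)
    (sigma : seq (nonempty_open X) -> nonempty_open X)
    (s : seq (nonempty_open X)) (i : nat) : first_meeting U sigma s i ->
  advance U sigma s = iter i (accept sigma) s.
Proof.
move=> [mi lti]; rewrite /advance; congr iter.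
apply: xget_unique => // k [mk ltk]; case: (ltngtP k i) => // [/lti|/ltk].
  by rewrite mk.
by rewrite mi.
Qed.

(** The auxiliary play just after the real answers [t].  It is computed from [t]
    alone, as a strategy on [U] sees nothing else; it follows [sigma] as long as
    [sigma] keeps meeting [U]. *)
Definition auxiliary (X : topologicalType) (U : set X) (hU : open U)
    (sigma : seq (nonempty_open X) -> nonempty_open X)
    (t : seq (nonempty_open (set_type U))) : seq (nonempty_open X) :=
  foldl (fun s V => rcons (advance U sigma s) (extend_move hU V)) [::] t.

Definition open_subspace_strategy (X : topologicalType) (U : set X)
    (hU : open U) (hU0 : U !=set0)
    (sigma : seq (nonempty_open X) -> nonempty_open X)
    (t : seq (nonempty_open (set_type U))) : nonempty_open (set_type U) :=
  restrict_move hU0 (sigma (advance U sigma (auxiliary hU sigma t))).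

(** Against an infinite sequence [V] of real answers, the stages of the
    auxiliary game are indexed by pairs [(j, i)]: the real answers
    [V 0, ..., V j.-1] have been used, and [i] further moves of [sigma] have
    been accepted since.  This indexing describes also the plays in which
    [sigma] stops meeting [U], where [j] is eventually constant. *)
Definition stage_play (X : topologicalType) (U : set X) (hU : open U)
    (sigma : seq (nonempty_open X) -> nonempty_open X)
    (V : nat -> nonempty_open (set_type U)) (p : nat * nat) :
    seq (nonempty_open X) :=
  iter p.2 (accept sigma) (auxiliary hU sigma (mkseq V p.1)).

Definition next_stage (X : topologicalType) (U : set X) (hU : open U)
    (sigma : seq (nonempty_open X) -> nonempty_open X)
    (V : nat -> nonempty_open (set_type U)) (p : nat * nat) : nat * nat :=
  if meets U (sigma (stage_play hU sigma V p)) then (p.1.+1, 0) else (p.1, p.2.+1).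

Definition stage (X : topologicalType) (U : set X) (hU : open U)
    (sigma : seq (nonempty_open X) -> nonempty_open X)
    (V : nat -> nonempty_open (set_type U)) (n : nat) : nat * nat :=
  iter n (next_stage hU sigma V) (0, 0).

Definition auxiliary_answer (X : topologicalType) (U : set X) (hU : open U)
    (sigma : seq (nonempty_open X) -> nonempty_open X)
    (V : nat -> nonempty_open (set_type U)) (n : nat) : nonempty_open X :=
  let A := sigma (stage_play hU sigma V (stage hU sigma V n)) in
  if meets U A then extend_move hU (V (stage hU sigma V n).1) else A.

Lemma stage_idle (X : topologicalType) (U : set X) (hU : open U)
    (sigma : seq (nonempty_open X) -> nonempty_open X)
    (V : nat -> nonempty_open (set_type U)) (n k : nat) :
  let p := stage hU sigma V n in
  (k < p.2)%N -> ~~ meets U (sigma (stage_play hU sigma V (p.1, k))).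
Proof.
elim: n k => [|n IHn] k //=; rewrite -/(stage hU sigma V n) /next_stage.
case: ifPn => // nm /=; rewrite ltnS leq_eqVlt => /predU1P[->|]; last exact: IHn.
by rewrite -surjective_pairing.
Qed.

(** When [sigma] meets [U] at some stage, it does so for the first time since
    the last real answer, so this stage is the one that [advance] reaches. *)
Lemma advance_stage (X : topologicalType) (U : set X) (hU : open U)
    (sigma : seq (nonempty_open X) -> nonempty_open X)
    (V : nat -> nonempty_open (set_type U)) (n : nat) :
  let p := stage hU sigma V n in
  meets U (sigma (stage_play hU sigma V p)) ->
  advance U sigma (auxiliary hU sigma (mkseq V p.1)) = stage_play hU sigma V p.
Proof.
by move=> p mp; apply: advanceE; split=> // k; exact: stage_idle.
Qed.

Lemma stage_play_mkseq (X : topologicalType) (U : set X) (hU : open U)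
    (sigma : seq (nonempty_open X) -> nonempty_open X)
    (V : nat -> nonempty_open (set_type U)) (n : nat) :
  stage_play hU sigma V (stage hU sigma V n) =
  mkseq (auxiliary_answer hU sigma V) n.
Proof.
elim: n => [//|n IHn]; rewrite mkseqS -IHn /auxiliary_answer /=.
rewrite -/(stage hU sigma V n) {1}/next_stage; case: ifPn => // mn.
rewrite {1}/stage_play /= mkseqS /auxiliary foldl_rcons -/(auxiliary _ _ _).
by rewrite advance_stage.
Qed.

(** Moves of [sigma] missing [U] are copied.  A move meeting [U] is the one whose
    trace on [U] was proposed in the real game, so the real answer lies in it. *)
Lemma auxiliary_answer_sub (X : topologicalType) (U : set X) (hU : open U)
    (hU0 : U !=set0) (sigma : seq (nonempty_open X) -> nonempty_open X)
    (V : nat -> nonempty_open (set_type U)) (n : nat) :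
  (forall j, set_val (V j) `<=`
     set_val (open_subspace_strategy hU hU0 sigma (mkseq V j))) ->
  set_val (auxiliary_answer hU sigma V n) `<=`
  set_val (sigma (mkseq (auxiliary_answer hU sigma V) n)).
Proof.
move=> legal; rewrite -stage_play_mkseq /auxiliary_answer.
case: ifPn => mn; last by [].
rewrite extend_moveE => _ [x Vx <-].
have := legal _ x Vx.
by rewrite /open_subspace_strategy advance_stage// restrict_moveE.
Qed.

Lemma open_subspace_strategy_winning (X : topologicalType) (U : set X)
    (hU : open U) (hU0 : U !=set0)
    (sigma : seq (nonempty_open X) -> nonempty_open X) :
  winning_strategy sigma ->
  winning_strategy (open_subspace_strategy hU hU0 sigma).
Proof.
move=> win V V0 VS.
have legal j : set_val (V j) `<=`
    set_val (open_subspace_strategy hU hU0 sigma (mkseq V j)) by case: j.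
have sub n := @auxiliary_answer_sub _ _ hU hU0 sigma V n legal.
have denseW := win _ (sub 0) (fun k => sub k.+1).
move=> O O0 oO.
have [oO' O'0] := nonempty_open_image hU (conj oO O0).
have [_ [[y Oy <-] [n _ Wy]]] := denseW _ O'0 oO'.
(* the point [y] of [U] excludes that the [n]-th answer is a copied move *)
move: Wy; rewrite /auxiliary_answer; case: ifPn => [_|/asboolPn nm Ay].
  rewrite extend_moveE => -[z Vz /val_inj zy]; exists y; split=> //.
  by exists (stage hU sigma V n).1; rewrite // -zy.
by exfalso; apply: nm; exists (set_val y); split=> //; exact: set_valP.
Qed.

(* [set_type U] is the subtype of points of U with the subspace topology. *)
Theorem corollary1p3 (X : topologicalType) (hX : tychonoff_space X)
    (hX0 : [set: X] !=set0) (hfav : I_favorable X)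
    (U : set X) (hU : open U) (hU0 : U !=set0) :
  I_favorable (set_type U).
Proof.
have [sigma win] := hfav.
exists (open_subspace_strategy hU hU0 sigma).
exact: open_subspace_strategy_winning.
Qed.
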